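(* Let $k\in\{2,3\}$, let $n>k$, and let $\mathcal F=\{\boldsymbol f_1,\dots,\boldsymbol f_n\}\subset\mathbb R^k$ be an $(n,k)$ tight frame containing at least one unit vector. Then the following are equivalent: (i) $\mathcal F$ is rational; (ii) $\Lambda(\mathcal F)$ is a lattice; (iii) $Q_{\mathcal F}$ has separated values.
   Context: $\langle\cdot,\cdot\rangle$ is the usual inner product on $\mathbb R^k$ and $\|\cdot\|$ the Euclidean norm. A set $\mathcal F=\{\boldsymbol f_1,\dots,\boldsymbol f_n\}\subset\mathbb R^k$ is an $(n,k)$ tight frame if $n>k$, $\operatorname{span}_{\mathbb R}\{\boldsymbol f_1,\dots,\boldsymbol f_n\}=\mathbb R^k$, and there is a real $\gamma>0$ such that $\|\boldsymbol x\|^2=\gamma\sum_{i=1}^n\langle\boldsymbol f_i,\boldsymbol x\rangle^2$ for every $\boldsymbol x\in\mathbb R^k$. Let $G$ be the $k\times n$ matrix with columns $\boldsymbol f_1,\dots,\boldsymbol f_n$. Put $\Lambda(\mathcal F)=\operatorname{span}_{\mathbb Z}\{\boldsymbol f_1,\dots,\boldsymbol f_n\}=\{G\boldsymbol a:\boldsymbol a\in\mathbb Z^n\}$. A lattice is a discrete additive subgroup of $\mathbb R^k$. The norm-form of $\mathcal F$ is the quadratic form $Q_{\mathcal F}(\boldsymbol a)=\|G\boldsymbol a\|^2=\langle G^\top G\boldsymbol a,\boldsymbol a\rangle$. A quadratic form $Q(\boldsymbol a)=\langle H\boldsymbol a,\boldsymbol a\rangle$ on $\mathbb R^n$, with $H$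 a real symmetric $n\times n$ matrix, has separated values if $\inf\{|Q(\boldsymbol a)-Q(\boldsymbol b)|:\boldsymbol a,\boldsymbol b\in\mathbb Z^n,\ Q(\boldsymbol a)\ne Q(\boldsymbol b)\}>0$. $\mathcal F$ is rational if $\langle\boldsymbol f_i,\boldsymbol f_j\rangle\in\mathbb Q$ for all $1\le i,j\le n$. *)

(* Defs.v *)
From mathcomp Require Import all_boot all_order all_algebra.
From mathcomp Require Import all_classical all_reals all_analysis.

Set Implicit Arguments.
Unset Strict Implicit.
Unset Printing Implicit Defensive.

Import Order.TTheory GRing.Theory Num.Theory.
Import numFieldNormedType.Exports.

Local Open Scope classical_set_scope.
Local Open Scope ring_scope.

(* The library norm `|x| on 'cV[R]_k is the sup norm, hence the explicit
   Euclidean structure. *)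
Definition dotv (R : realType) (k : nat) (u v : 'cV[R]_k) : R :=
  \sum_(i < k) u i 0 * v i 0.

Definition enorm (R : realType) (k : nat) (u : 'cV[R]_k) : R :=
  Num.sqrt (dotv u u).

(* A frame is a family of n vectors; n counts vectors with repetition. *)
Definition tight_frame (R : realType) (n k : nat) (F : 'I_n -> 'cV[R]_k) :
    Prop :=
  [/\ (k < n)%N,
      <<codom F>>%VS = fullv
    & exists2 gamma : R, 0 < gamma &
        forall x : 'cV[R]_k,
          enorm x ^+ 2 = gamma * \sum_(i < n) dotv (F i) x ^+ 2].

Definition frame_mx (R : realType) (n k : nat) (F : 'I_n -> 'cV[R]_k) :
    'M[R]_(k, n) :=
  \matrix_(i < k, j < n) F j i 0.

Definition rational_frame (R : realType) (n k : nat) (F : 'I_n -> 'cV[R]_k) :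
    Prop :=
  forall i j : 'I_n, rational (dotv (F i) (F j)).

Definition intv (R : realType) (n : nat) (a : 'cV[int]_n) : 'cV[R]_n :=
  map_mx intr a.

Definition int_span (R : realType) (n k : nat) (F : 'I_n -> 'cV[R]_k) :
    set 'cV[R]_k :=
  range (fun a : 'cV[int]_n => frame_mx F *m intv R a).

(* The topology on 'cV[R]_k is the usual one (induced by the sup norm, hence
   also by enorm); L is discrete when all its points are isolated in L. *)
Definition is_lattice (R : realType) (k : nat) (L : set 'cV[R]_k) : Prop :=
  zmod_closed [in L] /\ isolated L = L.

Definition quad_form (R : realType) (n : nat) (H : 'M[R]_n) (a : 'cV[R]_n) :
    R :=
  dotv (H *m a) a.

(* Meant for symmetric H. The infimum is taken in the extended reals, where
   that of the empty set is +oo. *)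
Definition separated_values (R : realType) (n : nat) (H : 'M[R]_n) : Prop :=
  (0%E < ereal_inf
    [set (`| quad_form H (intv R p.1) - quad_form H (intv R p.2) |)%:E |
      p in [set p : 'cV[int]_n * 'cV[int]_n |
        quad_form H (intv R p.1) <> quad_form H (intv R p.2)]])%E.

(* The matrix of the norm-form a |-> enorm (frame_mx F *m a) ^+ 2. *)
Definition norm_form_mx (R : realType) (n k : nat) (F : 'I_n -> 'cV[R]_k) :
    'M[R]_n :=
  (frame_mx F)^T *m frame_mx F.

Lemma norm_form_mx_sym (R : realType) (n k : nat) (F : 'I_n -> 'cV[R]_k) :
  (norm_form_mx F)^T = norm_form_mx F.
Proof. by rewrite /norm_form_mx trmx_mul trmxK. Qed.

Lemma dotvE (R : realType) (k : nat) (u v : 'cV[R]_k) :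
  dotv u v = (u^T *m v) 0 0.
Proof. by rewrite mxE; apply: eq_bigr => i _; rewrite mxE. Qed.

Lemma norm_formE (R : realType) (n k : nat) (F : 'I_n -> 'cV[R]_k)
    (a : 'cV[R]_n) :
  quad_form (norm_form_mx F) a = enorm (frame_mx F *m a) ^+ 2.
Proof.
rewrite sqr_sqrtr; last by apply: sumr_ge0 => i _; rewrite -expr2 sqr_ge0.
by rewrite /quad_form /norm_form_mx !dotvE !trmx_mul trmxK !mulmxA.
Qed.

Lemma int_spanE (R : realType) (n k : nat) (F : 'I_n -> 'cV[R]_k) :
  int_span F = range (fun c : 'I_n -> int => \sum_(i < n) F i *~ c i).
Proof.
have E (c : 'I_n -> int) :
  frame_mx F *m intv R (\col_i c i) = \sum_(i < n) F i *~ c i.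
  apply/matrixP => i j; rewrite (ord1 j) mxE summxE; apply: eq_bigr => l _.
  by rewrite -scaler_int !mxE mulrC.
apply/seteqP; split => _ [a _ <-]; last by exists (\col_i a i).
by exists (fun i => a i 0) => //; rewrite -E; congr (_ *m intv R _);
  apply/matrixP => i j; rewrite mxE (ord1 j).
Qed.

(* Main.v *)
From HB Require Import structures.
Require Import Defs.
From mathcomp Require Import all_boot all_order all_algebra.
From mathcomp Require Import all_classical all_reals all_analysis.
From mathcomp Require Import lra.
Import Order.TTheory GRing.Theory Num.Theory.
Import numFieldNormedType.Exports.
Local Open Scope ring_scope.

(** The three properties are linked in a cycle: rational, hence separated
    values, hence lattice, hence rational.

    If all the inner products of the frame are rational, they have a common
    denominator D, and the norm-form Q takes its values on integer vectors in
    (1/D)Z, so that distinct values differ by at least 1/D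
    ([rational_separated]).

    If Q has separated values, then its nonzero values are bounded away from
    its value 0 at the origin.  Since Q(a) is the squared length of Ga, with G
    the matrix whose columns are the frame vectors, the nonzero vectors of the
    span are bounded away from 0, and a subgroup is discrete as soon as 0 is
    isolated in it ([separated_lattice]).

    The substantial step is [lattice_rational].  Let B consist of k linearly
    independent columns of G, and write G = BA.  When the span is discrete,
    Dirichlet approximation forces A to be rational: if q times a column c of A
    is close to an integer vector p, then B(qc - p) is a short vector of the
    lattice, hence zero, and c = p/q ([simultaneous_dirichlet],
    [lattice_coord_rational]).  Tightness says that g G G^T = 1 for some g > 0
    ([tight_frame_mx]), that is, B (g A A^T) B^T = 1.  Therefore
    B^T B = g^-1 (A A^T)^-1, and the Gram matrix of the frame is
                 G^T G = g^-1 A^T (A A^T)^-1 A,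
    a rational matrix up to the factor g^-1.  A unit vector of the frame puts a
    1 on the diagonal of G^T G, which makes g itself rational. *)

(** * Euclidean norm, Gram matrix and discreteness *)

Lemma enorm_sqr (R : realType) (k : nat) (u : 'cV[R]_k) :
  enorm u ^+ 2 = dotv u u.
Proof. by rewrite sqr_sqrtr// sumr_ge0// => i _; rewrite -expr2 sqr_ge0. Qed.

Lemma norm_form_mxE (R : realType) (n k : nat) (F : 'I_n -> 'cV[R]_k) i j :
  norm_form_mx F i j = dotv (F i) (F j).
Proof. by rewrite mxE; apply: eq_bigr => l _; rewrite !mxE. Qed.

(** By translation invariance, a subgroup is discrete when no nonzero element is
    close to 0.  Bounding the coordinates separately expresses closeness in the
    sup norm, which induces the topology. *)
Lemma is_latticeP (R : realType) (k : nat) (L : set 'cV[R]_k) :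
  is_lattice L <->
  zmod_closed [in L] /\
  exists2 e : R, 0 < e &
    forall v, L v -> (forall i, `|v i 0| < e) -> v = 0.
Proof.
split=> -[zL].
  move=> isoL; split=> //; have [L0 _] := zL.
  have : isolated L 0 by rewrite isoL; rewrite inE in L0.
  case=> _ [V /nbhs_ballP[e /= e0 eV] VL]; exists e => // v Lv ve.
  suff : (V `&` L)%classic v by rewrite VL.
  split=> //; apply: eV; split=> // i j.
  by rewrite (ord1 j) /ball /= mxE sub0r normrN.
move=> [e e0 eL]; split=> //; apply/seteqP; split=> [x /isolatedS//|x Lx].
split; first by rewrite inE.
exists (ball x e); first exact: nbhsx_ballx.
apply/seteqP; split=> [y [[_ xy] Ly]|_ ->]; last by split=> //; exact: ballxx.
apply/esym/eqP; rewrite -subr_eq0; apply/eqP/eL.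
  by have [_ /(_ x y)] := zL; rewrite !inE; apply.
by move=> i; have := xy i 0; rewrite /ball /= !mxE.
Qed.

Lemma int_span_zmod_closed (R : realType) (n k : nat) (F : 'I_n -> 'cV[R]_k) :
  zmod_closed [in int_span F].
Proof.
split=> [|x y].
  by rewrite inE; exists 0 => //; rewrite /intv map_mx0 mulmx0.
rewrite !inE => -[a _ <-] [b _ <-]; exists (a - b) => //.
by rewrite /intv map_mxB mulmxBr.
Qed.

Lemma int_span_mem (R : realType) (n k : nat) (F : 'I_n -> 'cV[R]_k) j :
  int_span F (F j).
Proof.
exists (delta_mx j 0) => //; rewrite /intv map_delta_mx -colE.
by apply/colP => i; rewrite !mxE.
Qed.

(** * Rationality of the coordinates of lattice vectors *)

(** Dirichlet's pigeonhole: cut the unit cube into (N+1)^k cells of side 1/(N+1)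
    and consider one more multiple of c than there are cells.  Two of them have
    their fractional parts in the same cell, and q is their difference. *)
Lemma simultaneous_dirichlet (R : realType) (k : nat) (c : 'I_k -> R)
    (N : nat) :
  exists2 q : nat, (0 < q)%N &
    exists p : 'I_k -> int, forall i,
      `|c i *+ q - (p i)%:~R| < N.+1%:R^-1.
Proof.
pose fr (m : nat) i : R := c i *+ m - (Num.floor (c i *+ m))%:~R.
have fr_itv m i : 0 <= fr m i < 1.
  have := floor_itv (c i *+ m); rewrite intrD => /andP[? ?].
  by rewrite subr_ge0 ltrBlDl; apply/andP.
have trN m i : (Num.trunc (N.+1%:R * fr m i) < N.+1)%N.
  have /andP[f0 f1] := fr_itv m i.
  by rewrite truncn_lt_nat ?mulr_ge0// gtr_pMr.
(* The cell that contains the fractional parts of m * c. *)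
pose g (m : 'I_(#|{ffun 'I_k -> 'I_N.+1}|.+1)) : {ffun 'I_k -> 'I_N.+1} :=
  [ffun i => Ordinal (trN m i)].
have : ~~ injectiveb g.
  by apply/negP => /injectiveP /leq_card; rewrite card_ord ltnn.
move=> /injectivePn[m1 [m2 m12 gm]].
wlog lt12 : m1 m2 m12 gm / (m1 < m2)%N.
  move=> W; move: (m12); rewrite neq_ltn => /orP[|] h; first exact: (W m1 m2).
  by apply: (W m2 m1) => //; rewrite eq_sym.
exists (m2 - m1)%N; first by rewrite subn_gt0.
exists (fun i => Num.floor (c i *+ m2) - Num.floor (c i *+ m1)) => i.
have -> : c i *+ (m2 - m1) -
    (Num.floor (c i *+ m2) - Num.floor (c i *+ m1))%:~R = fr m2 i - fr m1 i.
  rewrite mulrnBr ?(ltnW lt12)// intrB /fr.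
  by rewrite !opprB addrACA [RHS]addrACA; congr (_ + _); rewrite addrC.
have /andP[a0 _] := fr_itv m1 i; have /andP[b0 _] := fr_itv m2 i.
have N0 : 0 < N.+1%:R :> R by rewrite ltr0n.
have := congr1 (fun h : {ffun _ -> _} => val (h i)) gm; rewrite /g !ffunE /=.
have := truncn_itv (mulr_ge0 (ltW N0) a0).
have := truncn_itv (mulr_ge0 (ltW N0) b0).
move=> + + E; rewrite E => /andP[b1 b2] /andP[a1 a2].
rewrite -(ltr_pM2l N0) mulfV ?gt_eqF// -[X in X * _](gtr0_norm N0) -normrM.
move: a1 a2 b1 b2; move: (Num.trunc _) => t.
move: (fr m1 i) (fr m2 i) => y z.
by rewrite -[t.+1%:R]natr1 => *; rewrite ltr_norml; apply/andP; split; lra.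
Qed.

(** An approximation of q c by an integer vector p yields the element
    B (q c - p) of L, which is short when the approximation is good.  Since L
    has no short nonzero element, q c = p exactly. *)
Lemma lattice_coord_rational (R : realType) (k : nat) (L : set 'cV[R]_k)
    (B : 'M[R]_k) (c : 'cV[R]_k) :
  is_lattice L -> B \in unitmx -> (forall j, L (col j B)) -> L (B *m c) ->
  forall i, rational (c i 0).
Proof.
move=> /is_latticeP[zL [e e0 eL]] uB LB Lc.
pose Lz : zmodClosed 'cV[R]_k :=
  HB.pack [in L] (GRing.isZmodClosed.Build _ [in L] zL).
(* S bounds the operator norm of B for the sup norm, so an approximation of
   precision 1/(N+1) suffices as soon as S/(N+1) < e. *)
pose S := \sum_i \sum_j `|B i j|.
have S0 : 0 <= S by do 2!apply: sumr_ge0 => ? _.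
have S_row i : \sum_j `|B i j| <= S.
  by rewrite /S [leRHS](bigD1 i)//= lerDl; do 2!apply: sumr_ge0 => ? _.
pose N := Num.trunc (S / e).
have SN : S * N.+1%:R^-1 < e.
  by rewrite ltr_pdivrMr ?ltr0n// mulrC -ltr_pdivrMr// truncnS_gt.
have [q q0 [p cp]] := simultaneous_dirichlet R k (fun i => c i 0) N.
pose d := c *+ q - \col_i (p i)%:~R.
have LBd : L (B *m d).
  have -> : B *m d = (B *m c) *+ q - \sum_j col j B *~ p j.
    rewrite mulmxBr; congr (_ - _).
      by rewrite -[c *+ q]scaler_nat -scalemxAr scaler_nat.
    apply/colP => i; rewrite mxE summxE; apply: eq_bigr => j _.
    by rewrite -scaler_int !mxE mulrC.
  suff : ((B *m c) *+ q - \sum_j col j B *~ p j) \in Lz by rewrite inE.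
  apply: rpredB; first by rewrite rpredMn// inE.
  by apply: rpred_sum => j _; rewrite rpredMz// inE; exact: LB.
have Bd0 : B *m d = 0.
  apply: eL => // i; apply: le_lt_trans SN.
  rewrite mxE (le_trans (ler_norm_sum _ _ _))//.
  apply: le_trans (ler_wpM2r _ (S_row i)); last by rewrite invr_ge0.
  rewrite mulr_suml ler_sum// => j _; rewrite normrM ler_wpM2l//.
  by rewrite !mxE mulmxnE ltW//; exact: cp.
have d0 : d = 0 by rewrite -(mulKmx uB d) Bd0 mulmx0.
move=> i; have cE : c i 0 *+ q = (p i)%:~R.
  by have /colP/(_ i)/eqP := d0; rewrite !mxE mulmxnE subr_eq0 => /eqP.
have q_neq0 : q%:R != 0 :> R by rewrite pnatr_eq0 -lt0n.
exists ((p i)%:~R / q%:R) => //.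
by rewrite rmorphM fmorphV /= ratr_int ratr_nat -cE
  -[c i 0 *+ q]mulr_natr mulfK.
Qed.

(** * Tight frames that span a lattice *)

(** Polarization turns the tightness identity, which only involves squares,
    into <x, y> = gamma * sum_i <f_i, x> <f_i, y>; evaluated on the canonical
    basis, this is the matrix identity. *)
Lemma tight_frame_mx (R : realType) (n k : nat) (F : 'I_n -> 'cV[R]_k) :
  tight_frame F ->
  exists2 gamma : R, 0 < gamma &
    gamma *: (frame_mx F *m (frame_mx F)^T) = 1%:M.
Proof.
move=> [_ _ [g g0 Fg]]; exists g => //.
have {}Fg x : dotv x x = g * \sum_i dotv (F i) x ^+ 2.
  by rewrite -Fg enorm_sqr.
have dotvD (u v w : 'cV[R]_k) : dotv u (v + w) = dotv u v + dotv u w.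
  by rewrite !dotvE mulmxDr mxE.
have dotvC (u v : 'cV[R]_k) : dotv u v = dotv v u.
  by apply: eq_bigr => i _; rewrite mulrC.
have Fxy x y : dotv x y = g * \sum_i dotv (F i) x * dotv (F i) y.
  have := Fg (x + y); rewrite dotvD ![dotv (x + y) _]dotvC !dotvD.
  rewrite (dotvC y x) !Fg.
  have -> : \sum_i dotv (F i) (x + y) ^+ 2 = \sum_i dotv (F i) x ^+ 2 +
      (\sum_i dotv (F i) x * dotv (F i) y) *+ 2 + \sum_i dotv (F i) y ^+ 2.
    rewrite -sumrMnl -!big_split /=; apply: eq_bigr => i _.
    by rewrite dotvD sqrrD.
  move: (dotv x y) (\sum_i dotv (F i) x ^+ 2) (\sum_i dotv (F i) y ^+ 2).
  by move: (\sum_i _ * _) => s p X Y h; lra.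
have dotd (u : 'cV[R]_k) i : dotv u (delta_mx i 0) = u i 0.
  rewrite /dotv (bigD1 i)//= mxE !eqxx mulr1 big1 ?addr0// => j ji.
  by rewrite mxE (negPf ji) mulr0.
apply/matrixP => i j; have := Fxy (delta_mx j 0) (delta_mx i 0).
rewrite dotd !mxE andbT => ->; congr (_ * _).
by apply: eq_bigr => l _; rewrite !dotd !mxE mulrC.
Qed.

(** In coordinates with respect to k independent frame vectors, discreteness
    makes the frame rational, and tightness then determines the Gram matrix
    from these coordinates up to a scalar, which the unit vector fixes. *)
Lemma lattice_rational (R : realType) (n k : nat) (F : 'I_n -> 'cV[R]_k) :
  tight_frame F -> (exists i, enorm (F i) = 1) ->
  is_lattice (int_span F) -> rational_frame F.
Proof.
move=> /tight_frame_mx[g g0]; set G := frame_mx F => GG [i0 Fi0] latF.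
have GTfull : row_full G^T.
  by apply/row_fullP; exists (g *: G); rewrite -scalemxAl.
pose f := fullrankfun GTfull; pose B := colsub f G.
have uB : B \in unitmx by rewrite -unitmx_tr trmx_mxsub fullrowsub_unit.
have colF j : col j G = F j by apply/colP => i; rewrite !mxE.
have LB j : int_span F (col j B).
  have -> : col j B = F (f j) by rewrite -colF; apply/colP => i; rewrite !mxE.
  exact: int_span_mem.
have [A GE] : exists A, G = B *m A.
  by exists (invmx B *m G); rewrite mulKVmx.
have [A' AE] : exists A' : 'M[rat]_(k, n), A = map_mx ratr A'.
  have ratA i j : exists r : rat, A i j = ratr r.
    have BA : B *m col j A = F j by rewrite colE mulmxA -colE -GE.
    have [||r _ rE] := lattice_coord_rational _ _ _ B (col j A) latF uB _ _ i.
    - exact: LB.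
    - by rewrite BA; exact: int_span_mem.
    by exists r; rewrite rE [RHS]mxE.
  exists (\matrix_(i, j) projT1 (cid (ratA i j))).
  by apply/matrixP => i j; rewrite !mxE; case: cid.
pose P := A'^T *m invmx (A' *m A'^T) *m A'.
have gram i j : dotv (F i) (F j) = g^-1 * ratr (P i j).
  (* A right inverse of a square matrix is a left inverse, which moves B next to
     B^T. *)
  have /mulmx1C AAB : B *m (g *: (A *m A^T) *m B^T) = 1%:M.
    by rewrite -GG GE trmx_mul !mulmxA -scalemxAr -scalemxAl !mulmxA.
  have uAA : A *m A^T \in unitmx.
    move: AAB; rewrite -mulmxA => /mulmx1_unit[+ _].
    by rewrite unitmxZ ?unitfE ?gt_eqF.
  have BB : B^T *m B = g^-1 *: invmx (A *m A^T).
    have AABB : A *m A^T *m (B^T *m B) = g^-1 *: 1%:M.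
      by rewrite -AAB -!scalemxAl scalerA mulVf ?gt_eqF// scale1r !mulmxA.
    by rewrite -[LHS](mulKmx uAA) AABB -scalemxAr mulmx1.
  rewrite -norm_form_mxE /norm_form_mx -/G GE trmx_mul mulmxA -(mulmxA A^T) BB.
  rewrite -scalemxAr -scalemxAl mxE.
  rewrite /P AE map_trmx -map_mxM -map_invmx -!map_mxM.
  by rewrite mxE.
have gE : g^-1 = ratr (P i0 i0)^-1.
  have : dotv (F i0) (F i0) = 1 by rewrite -enorm_sqr Fi0 expr1n.
  by rewrite gram fmorphV /= => /mulr1_eq <-; rewrite invrK.
by move=> i j; exists ((P i0 i0)^-1 * P i j) => //; rewrite gram gE rmorphM.
Qed.

(** * Separated values *)

Lemma common_denominator (I : finType) (x : I -> rat) :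
  exists2 D : nat, (0 < D)%N & forall i, D%:R * x i \is a Num.int.
Proof.
exists (\prod_i `|denq (x i)|)%N.
  by apply: prodn_gt0 => i; rewrite absz_gt0 denq_neq0.
move=> i; rewrite (bigD1 i)//= natrM mulrAC rpredM ?natr_int//.
by rewrite pmulrn absz_denq mulrC -numqE intr_int.
Qed.

(** Q takes its values in (1/D)Z, where D is a common denominator of the inner
    products. *)
Lemma rational_separated (R : realType) (n k : nat) (F : 'I_n -> 'cV[R]_k) :
  rational_frame F -> separated_values (norm_form_mx F).
Proof.
move=> ratF.
pose x (p : 'I_n * 'I_n) : rat := projT1 (cid2 (ratF p.1 p.2)).
have xE i j : dotv (F i) (F j) = ratr (x (i, j)).
  by rewrite /x; case: cid2.
have [D D0 Dx] := common_denominator _ x.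
have intQ a : D%:R * quad_form (norm_form_mx F) (intv R a) \is a Num.int.
  rewrite /quad_form /dotv mulr_sumr rpred_sum// => i _.
  rewrite mxE mulr_suml mulr_sumr rpred_sum// => j _.
  rewrite !mulrA; apply: rpredM; last by rewrite mxE intr_int.
  apply: rpredM; last by rewrite mxE intr_int.
  rewrite norm_form_mxE xE -(ratr_nat R D) -rmorphM.
  by have /intrP[z ->] := Dx (i, j); rewrite /= ratr_int intr_int.
have DR0 : 0 < D%:R :> R by rewrite ltr0n.
apply: (@lt_le_trans _ _ (D%:R^-1)%:E); first by rewrite lte_fin invr_gt0.
apply/ereal_infP => _ [[a b] /= /eqP ab <-].
rewrite lee_fin -(ler_pM2l DR0) mulfV ?gt_eqF//.
rewrite -[X in X * _](gtr0_norm DR0) -normrM mulrBr norm_intr_ge1//.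
  by rewrite rpredB.
by rewrite -mulrBr mulf_neq0 ?subr_eq0// gt_eqF.
Qed.

(** Comparing the other values of Q with Q(0) = 0 bounds the nonzero squared
    lengths from below. *)
Lemma separated_lattice (R : realType) (n k : nat) (F : 'I_n -> 'cV[R]_k) :
  separated_values (norm_form_mx F) -> is_lattice (int_span F).
Proof.
move=> sepF; apply/is_latticeP; split; first exact: int_span_zmod_closed.
have [e e0 eQ] : exists2 e : R, 0 < e &
    forall a, quad_form (norm_form_mx F) (intv R a) != 0 ->
    e <= quad_form (norm_form_mx F) (intv R a).
  have lb a : quad_form (norm_form_mx F) (intv R a) != 0 ->
      (ereal_inf [set (`|quad_form (norm_form_mx F) (intv R p.1) -
         quad_form (norm_form_mx F) (intv R p.2)|)%:E |
         p in [set p : 'cV[int]_n * 'cV[int]_n |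
           quad_form (norm_form_mx F) (intv R p.1) <>
           quad_form (norm_form_mx F) (intv R p.2)]]%classic <=
       (quad_form (norm_form_mx F) (intv R a))%:E)%E.
    move=> Qa; have Q0 : quad_form (norm_form_mx F) (intv R 0) = 0.
      by rewrite /quad_form dotvE /intv map_mx0 mulmx0 mxE.
    apply: ereal_inf_lbound; exists (a, 0) => /=; rewrite Q0; first exact/eqP.
    by rewrite subr0 ger0_norm// norm_formE sqr_ge0.
  move: sepF lb; rewrite /separated_values; case: ereal_inf => [r| |] //.
    by rewrite lte_fin => r0 lb; exists r => // a /lb; rewrite lee_fin.
  by move=> _ lb; exists 1 => // a /lb.
(* If the coordinates of v are less than d in absolute value, then
   ||v||^2 <= k d^2 <= k d < e, where the second inequality needs d <= 1 and the
   denominator k + 1 makes the last one strict. *)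
pose d := Num.min 1 (e / k.+1%:R).
have d0 : 0 < d by rewrite lt_min ltr01 divr_gt0.
exists d => // _ [a _ <-]; set v := frame_mx F *m _ => vd.
have QE : quad_form (norm_form_mx F) (intv R a) = \sum_i v i 0 ^+ 2.
  by rewrite norm_formE enorm_sqr; apply: eq_bigr => i _; rewrite expr2.
have Qlt : \sum_i v i 0 ^+ 2 < e.
  apply: (@le_lt_trans _ _ (\sum_(i < k) d)).
    apply: ler_sum => i _; rewrite -real_normK ?num_real//.
    have vi1 : `|v i 0| <= 1 by rewrite (le_trans (ltW (vd i)))// ge_min lexx.
    by rewrite (le_trans _ (ltW (vd i)))// expr2 ler_piMl.
  rewrite sumr_const card_ord.
  have : d <= e / k.+1%:R by rewrite ge_min lexx orbT.
  rewrite ler_pdivlMr ?ltr0n// => de; apply: lt_le_trans de.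
  by rewrite mulr_natr mulrS ltrDr.
have /eqP : \sum_i v i 0 ^+ 2 = 0.
  apply/eqP/negPn/negP => Q0; have := eQ a; rewrite QE => /(_ Q0).
  by rewrite leNgt Qlt.
rewrite psumr_eq0 => [/allP v0|i _]; last exact: sqr_ge0.
apply/colP => i; rewrite [RHS]mxE; apply/eqP.
by have := v0 i (mem_index_enum _); rewrite sqrf_eq0.
Qed.

Theorem theorem2 (R : realType) (n k : nat) (F : 'I_n -> 'cV[R]_k)
    (hk : k = 2%N \/ k = 3%N) (hF : tight_frame F)
    (hunit : exists i : 'I_n, enorm (F i) = 1) :
  (rational_frame F <-> is_lattice (int_span F)) /\
  (is_lattice (int_span F) <-> separated_values (norm_form_mx F)).
Proof.
have lat_rat := lattice_rational _ _ _ _ hF hunit.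
have rat_sep := rational_separated _ _ _ F.
have sep_lat := separated_lattice _ _ _ F.
by split; split; auto.
Qed.
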